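(* Let $M$ be a finite-dimensional smooth manifold, let $g,\widetilde{g}$ be two Riemannian metrics on $M$, and let $J$ be the unique tensor field of type $(1,1)$ on $M$ such that $\widetilde{g}(X,Y)=g(X,JY)=g(JX,Y)$ for all $X,Y\in\mathcal{X}(M)$. Let $\nabla,\widetilde{\nabla}$ be the Levi-Civita connections of $g,\widetilde{g}$ and let $A=\widetilde{\nabla}-\nabla$. Then $(M,\widetilde{g},A)$ is a formal Frobenius structure if and only if for all $X,Y,Z\in\mathcal{X}(M)$ $$g\left(Y,(\nabla_XJ)Z-(\nabla_ZJ)X\right)=g\left(X,(\nabla_ZJ)Y\right)-g\left(Z,(\nabla_XJ)Y\right).$$
   Context: $\mathcal{X}(M)$ denotes the smooth vector fields on $M$. For a Riemannian metric $h$ on $M$ and a tensor field $A$ of type $(1,2)$, the triple $(M,h,A)$ is called a formal Frobenius structure if (i) $h(A(X,Y),Z)=h(X,A(Y,Z))$ for all $X,Y,Z\in\mathcal{X}(M)$, and (ii) $A(X,Y)=A(Y,X)$ for all $X,Y\in\mathcal{X}(M)$. The difference of connections is $A(X,Y)=\widetilde{\nabla}_XY-\nabla_XY$. *)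

(* Defs.v *)
From HB Require Import structures.
From mathcomp Require Import all_boot all_order all_algebra.
From mathcomp Require Import all_classical all_reals.
From mathcomp Require Import topology normedtype derive.
Import Order.TTheory GRing.Theory Num.Theory.
Import numFieldNormedType.Exports.

Set Implicit Arguments.
Unset Strict Implicit.
Unset Printing Implicit Defensive.

Local Open Scope classical_set_scope.
Local Open Scope ring_scope.

(* Differential geometry is set up with the conventions of Helgason (and
   O'Neill): a vector field is a derivation of the algebra C^oo(M), and a tensor
   field with vector field arguments is a C^oo(M)-multilinear map. *)

Section Ck.
Context {R : realType} {n : nat}.
Implicit Types (U : set 'rV[R]_n) (f g : 'rV[R]_n -> R).

(* f is of class C^k on the open set U: all its iterated partial derivatives of
   order at most k exist and are continuous on U; values of f outside U are
   irrelevant. *)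
Fixpoint is_Ck (k : nat) U f : Prop :=
  (forall x, U x -> {for x, continuous f}) /\
  if k is k'.+1 then
    forall i : 'I_n, (forall x, U x -> derivable f x ('e_i)) /\
      is_Ck k' U (fun x => 'D_('e_i) f x)
  else True.

Definition is_smooth U f : Prop := forall k, is_Ck k U f.

Lemma is_Ck_eq k U f g : open U -> (forall x, U x -> f x = g x) ->
  is_Ck k U f -> is_Ck k U g.
Proof.
move=> oU.
have nearU (h h' : 'rV[R]_n -> R) (E : forall x, U x -> h x = h' x) x : U x ->
    \forall y \near x, h y = h' y.
  by move=> Ux; apply: filterS E _; exact: open_nbhs_nbhs.
have contU (h h' : 'rV[R]_n -> R) (E : forall x, U x -> h x = h' x) x : U x ->
    {for x, continuous h} -> {for x, continuous h'}.
  move=> Ux; rewrite /prop_for /continuous_at -E// => ch.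
  by apply: cvg_trans ch; exact: (@near_eq_cvg _ _ (nbhs x) _ _ _ (nearU _ _ E _ Ux)).
elim: k f g => [|k IH] f g fg /= [cf df]; split.
- by move=> x Ux; exact: contU fg _ Ux (cf x Ux).
- by [].
- by move=> x Ux; exact: contU fg _ Ux (cf x Ux).
- move=> i; have [dfi Cfi] := df i; split.
    by move=> x Ux; apply: near_eq_derivable (dfi x Ux); exact: nearU fg _ Ux.
  apply: IH Cfi => x Ux; apply: near_eq_derive; exact: nearU fg _ Ux.
Qed.

Lemma is_CkS k U f : is_Ck k.+1 U f -> is_Ck k U f.
Proof.
elim: k f => [|k IH] f [cf df]; first by split.
split=> [x Ux|i]; first exact: cf.
by have [dfi Cfi] := df i; split=> [x Ux|]; [exact: dfi|exact: IH].
Qed.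

Lemma is_Ck_cst k U (c : R) : is_Ck k U (cst c).
Proof.
elim: k c => [|k IH] c; split=> //; try by move=> x _; exact: cst_continuous.
move=> /= i; split=> [x _|]; first exact: derivable_cst.
rewrite (_ : (fun _ => _) = cst 0); first exact: IH.
by apply/funext => x; rewrite derive_cst.
Qed.

Lemma is_CkD k U f g : open U -> is_Ck k U f -> is_Ck k U g ->
  is_Ck k U (f + g).
Proof.
move=> oU; elim: k f g => [|k IH] f g [cf df] [cg dg]; split=> //.
- by move=> x Ux; apply: continuousD; [exact: cf|exact: cg].
- by move=> x Ux; apply: continuousD; [exact: cf|exact: cg].
- move=> i; have [dfi Cfi] := df i; have [dgi Cgi] := dg i; split.
    by move=> x Ux; apply: derivableD; [exact: dfi|exact: dgi].
  apply: is_Ck_eq (IH _ _ Cfi Cgi) => // x Ux.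
  by rewrite deriveD; [|exact: dfi|exact: dgi].
Qed.

Lemma is_CkM k U f g : open U -> is_Ck k U f -> is_Ck k U g ->
  is_Ck k U (f * g).
Proof.
move=> oU; elim: k f g => [|k IH] f g Cf Cg.
  split=> // x Ux; apply: continuousM; [exact: Cf.1|exact: Cg.1].
have [cf df] := Cf; have [cg dg] := Cg; split.
  by move=> x Ux; apply: continuousM; [exact: cf|exact: cg].
move=> i; have [dfi Cfi] := df i; have [dgi Cgi] := dg i; split.
  by move=> x Ux; apply: derivableM; [exact: dfi|exact: dgi].
apply: (@is_Ck_eq _ _ (f * (fun x => 'D_('e_i) g x) +
                       g * (fun x => 'D_('e_i) f x))) => //.
  by move=> x Ux; rewrite deriveM; [|exact: dfi|exact: dgi].
by apply: is_CkD => //; apply: IH => //; exact: is_CkS.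
Qed.

End Ck.

(* A homeomorphism between open sets chart_dom and chart_ran, given by total
   functions whose values outside these sets are irrelevant. *)
Record chart (R : realType) (n : nat) (T : topologicalType) := Chart {
  chart_dom : set T;
  chart_ran : set 'rV[R]_n;
  chart_fun :> T -> 'rV[R]_n;
  chart_inv : 'rV[R]_n -> T;
  chart_dom_open : open chart_dom;
  chart_ran_open : open chart_ran;
  chart_funS : forall p, chart_dom p -> chart_ran (chart_fun p);
  chart_invS : forall x, chart_ran x -> chart_dom (chart_inv x);
  chart_funK : forall p, chart_dom p -> chart_inv (chart_fun p) = p;
  chart_invK : forall x, chart_ran x -> chart_fun (chart_inv x) = x;
  chart_fun_continuous :
    forall p, chart_dom p -> {for p, continuous chart_fun};
  chart_inv_continuous :
    forall x, chart_ran x -> {for x, continuous chart_inv} }.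

Record smoothManifold (R : realType) (n : nat) := SmoothManifold {
  manifold_sort :> topologicalType;
  manifold_hausdorff : hausdorff_space manifold_sort;
  manifold_second_countable : @second_countable manifold_sort;
  atlas : set (chart R n manifold_sort);
  atlas_cover : forall p, exists2 c, atlas c & chart_dom c p;
  atlas_compatible : forall c d, atlas c -> atlas d -> forall j : 'I_n,
    is_smooth (chart_ran c `&` chart_inv c @^-1` chart_dom d)
              (fun x => d (chart_inv c x) 0 j) }.

Section SmoothFunctions.
Context {R : realType} {n : nat} (M : smoothManifold R n).

Definition smooth_on_manifold (f : M -> R) : Prop :=
  forall c, atlas c -> is_smooth (chart_ran c) (f \o chart_inv c).

Definition smooth_pred : {pred M -> R} :=
  fun f => `[< smooth_on_manifold f >].

Lemma smooth_subring_closed : subring_closed smooth_pred.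
Proof.
have smM f g : f \in smooth_pred -> g \in smooth_pred -> f * g \in smooth_pred.
  move=> /asboolP sf /asboolP sg; apply/asboolP => c Ac k.
  by apply: is_CkM; [exact: chart_ran_open|exact: sf|exact: sg].
have smC (a : R) : cst a \in smooth_pred.
  by apply/asboolP => c Ac k; exact: is_Ck_cst.
split=> [|f g sf sg|//]; first exact: smC.
have -> : f - g = f + cst (- 1) * g.
  by apply/funext => p; rewrite /GRing.add /GRing.opp /GRing.mul /= mulN1r.
move: sf (smM _ _ (smC (-1)) sg) => /asboolP sf /asboolP sg'.
apply/asboolP => c Ac k.
by apply: is_CkD; [exact: chart_ran_open|exact: sf|exact: sg'].
Qed.

HB.instance Definition _ :=
  GRing.isSubringClosed.Build (M -> R) smooth_pred smooth_subring_closed.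

Lemma smooth_scaler_closed : GRing.scaler_closed (smooth_pred : {pred M -> R^o}).
Proof.
move=> a f sf; have -> : a *: f = cst a * f by [].
by apply: rpredM => //; apply/asboolP => c Ac k; exact: is_Ck_cst.
Qed.

(* The algebra C^oo(M). *)
Record smoothFun := SmoothFun {
  smoothFun_val :> M -> R;
  _ : smoothFun_val \in smooth_pred }.

HB.instance Definition _ := [isSub for smoothFun_val].
HB.instance Definition _ := [Choice of smoothFun by <:].
HB.instance Definition _ := 
  GRing.SubChoice_isSubComPzRing.Build _ _ smoothFun
    smooth_subring_closed.
HB.instance Definition _ :=
  @GRing.isScaleClosed.Build R (M -> R^o) smooth_pred smooth_scaler_closed.
HB.instance Definition _ := [SubZmodule_isSubLmodule of smoothFun by <:].
End SmoothFunctions.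

Notation "'C^oo' ( M )" := (smoothFun M) (format "'C^oo' ( M )") : type_scope.

Section VectorFields.
Context {R : realType} {n : nat} (M : smoothManifold R n).

Record vectorField := VectorField {
  vectorField_fun :> C^oo(M) -> C^oo(M);
  vectorField_linear : linear vectorField_fun;
  vectorField_leibniz : forall f h : C^oo(M),
    vectorField_fun (f * h) = f * vectorField_fun h + vectorField_fun f * h }.

HB.instance Definition _ := gen_eqMixin vectorField.
HB.instance Definition _ := gen_choiceMixin vectorField.

Lemma vectorField_ext (X Y : vectorField) : (forall f, X f = Y f) -> X = Y.
Proof.
case: X Y => [X lX dX] [Y lY dY] /= /funext XY; subst Y.
by congr VectorField; exact: Prop_irrelevance.
Qed.

Implicit Types (X Y Z : vectorField) (f h : C^oo(M)).

HB.instance Definition _ X :=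
  GRing.isLinear.Build R C^oo(M) C^oo(M) *:%R X (vectorField_linear X).

Lemma smooth_scaler_mull (a : R) f h : a *: f * h = a *: (f * h).
Proof. by apply/val_inj/funext => p /=; exact: esym (mulrA _ _ _). Qed.

Lemma smooth_scaler_mulr (a : R) f h : f * (a *: h) = a *: (f * h).
Proof. by rewrite mulrC smooth_scaler_mull mulrC. Qed.

Fact vectorField_zero_linear : linear (fun _ : C^oo(M) => 0 : C^oo(M)).
Proof. by move=> a f h; rewrite scaler0 addr0. Qed.

Fact vectorField_zero_leibniz f h : 0 = f * 0 + 0 * h :> C^oo(M).
Proof. by rewrite mulr0 mul0r addr0. Qed.

Definition vectorField_zero : vectorField :=
  VectorField vectorField_zero_linear vectorField_zero_leibniz.

Fact vectorField_add_linear X Y : linear (fun h : C^oo(M) => X h + Y h).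
Proof. by move=> a f h; rewrite !linearP scalerDr addrACA. Qed.

Fact vectorField_add_leibniz X Y f h :
  X (f * h) + Y (f * h) = f * (X h + Y h) + (X f + Y f) * h.
Proof. by rewrite !vectorField_leibniz mulrDr mulrDl addrACA. Qed.

Definition vectorField_add X Y : vectorField :=
  VectorField (vectorField_add_linear X Y) (vectorField_add_leibniz X Y).

Fact vectorField_opp_linear X : linear (fun h : C^oo(M) => - X h).
Proof. by move=> a f h; rewrite linearP opprD scalerN. Qed.

Fact vectorField_opp_leibniz X f h :
  - X (f * h) = f * (- X h) + - X f * h.
Proof. by rewrite vectorField_leibniz opprD mulrN mulNr. Qed.

Definition vectorField_opp X : vectorField :=
  VectorField (vectorField_opp_linear X) (vectorField_opp_leibniz X).

Fact vectorField_scale_linear f X : linear (fun h : C^oo(M) => f * X h).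
Proof. by move=> a h k; rewrite linearP mulrDr smooth_scaler_mulr. Qed.

Fact vectorField_scale_leibniz f X h k :
  f * X (h * k) = h * (f * X k) + f * X h * k.
Proof. by rewrite vectorField_leibniz mulrDr mulrCA (mulrA f (X h)). Qed.

Definition vectorField_scale f X : vectorField :=
  VectorField (vectorField_scale_linear f X) (vectorField_scale_leibniz f X).

Fact lie_bracket_linear X Y : linear (fun h : C^oo(M) => X (Y h) - Y (X h)).
Proof.
by move=> a f h; rewrite !linearP scalerDr addrACA.
Qed.

Fact lie_bracket_leibniz X Y f h : X (Y (f * h)) - Y (X (f * h)) =
  f * (X (Y h) - Y (X h)) + (X (Y f) - Y (X f)) * h.
Proof.
rewrite !vectorField_leibniz (linearD X) (linearD Y) /= !vectorField_leibniz.
rewrite mulrBr mulrBl.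
rewrite (addrACA _ (X f * _)) opprD (addrACA (_ + _)).
rewrite (opprD (f * _)) (addrACA (f * _)) subrr addr0.
by rewrite (opprD (X f * _)) (addrACA (X f * _)) subrr add0r.
Qed.

Definition lie_bracket X Y : vectorField :=
  VectorField (lie_bracket_linear X Y) (lie_bracket_leibniz X Y).

Fact vectorField_addA : associative vectorField_add.
Proof. by move=> X Y Z; apply: vectorField_ext => f /=; rewrite addrA. Qed.
Fact vectorField_addC : commutative vectorField_add.
Proof. by move=> X Y; apply: vectorField_ext => f /=; rewrite addrC. Qed.
Fact vectorField_add0 : left_id vectorField_zero vectorField_add.
Proof. by move=> X; apply: vectorField_ext => f /=; rewrite add0r. Qed.
Fact vectorField_addN :
  left_inverse vectorField_zero vectorField_opp vectorField_add.
Proof. by move=> X; apply: vectorField_ext => f /=; rewrite addNr. Qed.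

HB.instance Definition _ := GRing.isZmodule.Build vectorField
  vectorField_addA vectorField_addC vectorField_add0 vectorField_addN.

Fact vectorField_scaleA f h X :
  vectorField_scale f (vectorField_scale h X) = vectorField_scale (f * h) X.
Proof. by apply: vectorField_ext => k /=; rewrite mulrA. Qed.
Fact vectorField_scale1 : left_id 1 vectorField_scale.
Proof. by move=> X; apply: vectorField_ext => k /=; rewrite mul1r. Qed.
Fact vectorField_scaleDr : right_distributive vectorField_scale +%R.
Proof. by move=> f X Y; apply: vectorField_ext => k /=; rewrite mulrDr. Qed.
Fact vectorField_scaleDl X : {morph vectorField_scale^~ X : f h / f + h}.
Proof. by move=> f h; apply: vectorField_ext => k /=; rewrite mulrDl. Qed.

(* The module X(M) over the ring C^oo(M). *)
HB.instance Definition _ := GRing.Zmodule_isLmodule.Build C^oo(M) vectorField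
  vectorField_scaleA vectorField_scale1 vectorField_scaleDr vectorField_scaleDl.

End VectorFields.

Section Riemannian.
Context {R : realType} {n : nat} (M : smoothManifold R n).
Local Notation X_M := (vectorField M).
Implicit Types (X Y Z : X_M) (f : C^oo(M)) (p : M).

(* The tangent vector X_p is the derivation f |-> (X f)(p). *)
Definition vanishes_at X p : Prop := forall f, X f p = 0.

Record riemannianMetric := RiemannianMetric {
  metric_form :> X_M -> X_M -> C^oo(M);
  metric_linearl : forall Z, scalar (metric_form ^~ Z);
  metric_linearr : forall X, scalar (metric_form X);
  metric_sym : forall X Y, metric_form X Y = metric_form Y X;
  metric_pos : forall X p, ~ vanishes_at X p -> 0 < metric_form X X p }.

Record tensor12 := Tensor12 {
  tensor12_fun :> X_M -> X_M -> X_M;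
  tensor12_linearl : forall Y, linear (tensor12_fun ^~ Y);
  tensor12_linearr : forall X, linear (tensor12_fun X) }.

Record connection := Connection {
  conn_fun :> X_M -> X_M -> X_M;
  conn_linearl : forall Y, linear (conn_fun ^~ Y);
  conn_additiver : forall X Y Z,
    conn_fun X (Y + Z) = conn_fun X Y + conn_fun X Z;
  (* Homogeneity over R is the case where f is constant. *)
  conn_leibniz : forall X f Y,
    conn_fun X (f *: Y) = f *: conn_fun X Y + X f *: Y }.

Definition is_levi_civita (g : riemannianMetric) (nabla : connection) : Prop :=
  (forall X Y, nabla X Y - nabla Y X = lie_bracket X Y) /\
  (forall X Y Z, X (g Y Z) = g (nabla X Y) Z + g Y (nabla X Z)).

Section ConnectionDifference.
Variables (nabla' nabla : connection).

Fact conn_diff_linearl Y : linear (fun X => nabla' X Y - nabla X Y).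
Proof.
by move=> f X Z; rewrite !conn_linearl scalerBr opprD addrACA.
Qed.

Fact conn_diff_linearr X : linear (fun Y => nabla' X Y - nabla X Y).
Proof.
move=> f Y Z; rewrite !conn_additiver !conn_leibniz scalerBr.
by rewrite opprD addrACA (opprD (f *: _)) (addrACA (f *: _)) subrr addr0.
Qed.

Definition conn_diff : tensor12 :=
  Tensor12 conn_diff_linearl conn_diff_linearr.

End ConnectionDifference.

(* The covariant derivative of J : (nabla_X J) Z. *)
Definition cov_deriv11 (nabla : connection) (J : {linear X_M -> X_M}) X Z :
    X_M :=
  nabla X (J Z) - J (nabla X Z).

Definition formal_frobenius (h : riemannianMetric) (A : tensor12) : Prop :=
  (forall X Y Z, h (A X Y) Z = h X (A Y Z)) /\
  (forall X Y, A X Y = A Y X).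

End Riemannian.

(* Main.v *)
(* Write a(X, Y, Z) = g'(A(X, Y), Z), which is symmetric in X and Y because both
   connections are torsion-free. Subtracting the compatibility of nabla with g
   from that of nabla' with g' gives
   g(Y, (nabla_X J) Z) = a(X, Y, Z) + a(X, Z, Y). Substituting this, the right
   hand condition becomes 2 a(X, Y, Z) = 2 a(Z, Y, X), and invariance under the
   exchange of the outer arguments, together with the symmetry in the first two,
   is the Frobenius identity a(X, Y, Z) = a(Y, Z, X). *)
Require Import Defs.
From mathcomp Require Import all_boot all_order all_algebra.
From mathcomp Require Import all_classical all_reals.
Import GRing.Theory.

Local Open Scope ring_scope.

Section Metric.
Context {R : realType} {n : nat} {M : smoothManifold R n}.
Implicit Types (g : riemannianMetric M) (X Y Z : vectorField M).

Lemma metricBl g X Y Z : g (X - Y) Z = g X Z - g Y Z.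
Proof. by rewrite addrC -scaleN1r metric_linearl mulN1r addrC. Qed.

Lemma metricBr g X Y Z : g X (Y - Z) = g X Y - g X Z.
Proof. by rewrite !(metric_sym _ X) metricBl. Qed.

(** Cancels the factor 2 in the converse: scaling by a nonzero real is injective. *)
Lemma smoothFun_double_inj : injective (fun f : C^oo(M) => f + f).
Proof.
move=> f h; rewrite /= -!mulr2n -!(scaler_nat (R := R)).
by apply: scalerI; rewrite Num.Theory.pnatr_eq0.
Qed.

Lemma conn_diff_sym g g' (nabla nabla' : connection M) X Y :
  is_levi_civita g nabla -> is_levi_civita g' nabla' ->
  conn_diff nabla' nabla X Y = conn_diff nabla' nabla Y X.
Proof.
move=> [tor _] [tor' _]; apply/subr0_eq => /=.
by rewrite opprD addrACA tor' -opprD tor subrr.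
Qed.

Lemma metric_cov_deriv g g' (J : {linear vectorField M -> vectorField M})
    (nabla nabla' : connection M) X Y Z :
  (forall X Y, g' X Y = g X (J Y)) ->
  is_levi_civita g nabla -> is_levi_civita g' nabla' ->
  g Y (cov_deriv11 nabla J X Z) =
    g' (conn_diff nabla' nabla X Y) Z + g' (conn_diff nabla' nabla X Z) Y.
Proof.
move=> gJ [_ comp] [_ comp'].
(* Both compatibilities differentiate the same function, [g' Y Z = g Y (J Z)]. *)
have := comp' X Y Z; rewrite gJ comp -gJ => /esym/eqP eqcomp.
rewrite /cov_deriv11 /= metricBr -gJ !metricBl.
rewrite !(metric_sym g' (_ Z) Y) addrACA -opprD (eqP eqcomp).
by rewrite opprD addrACA subrr add0r.
Qed.

End Metric.

Theorem proposition2p4 (R : realType) (n : nat) (M : smoothManifold R n)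
    (g g' : riemannianMetric M)
    (J : {linear vectorField M -> vectorField M})
    (hJ : forall X Y : vectorField M,
        g' X Y = g X (J Y) /\ g X (J Y) = g (J X) Y)
    (nabla nabla' : connection M)
    (hnabla : is_levi_civita g nabla)
    (hnabla' : is_levi_civita g' nabla') :
  formal_frobenius g' (conn_diff nabla' nabla) <->
  (forall X Y Z : vectorField M,
     g Y (cov_deriv11 nabla J X Z - cov_deriv11 nabla J Z X) =
     g X (cov_deriv11 nabla J Z Y) - g Z (cov_deriv11 nabla J X Y)).
Proof.
have gJ X Y : g' X Y = g X (J Y) by case: (hJ X Y).
have symA X Y := conn_diff_sym g g' nabla nabla' X Y hnabla hnabla'.
have covE X Y Z := metric_cov_deriv g g' J nabla nabla' X Y Z gJ hnabla hnabla'.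
have covB X Y Z : g Y (cov_deriv11 nabla J X Z - cov_deriv11 nabla J Z X) =
    g' (conn_diff nabla' nabla X Y) Z - g' (conn_diff nabla' nabla Z Y) X.
  (* By symmetry of the difference tensor, a(X, Z, Y) and a(Z, X, Y) cancel. *)
  by rewrite metricBr !covE (symA Z X) opprD addrACA subrr addr0.
(* This is the negative of the value in [covB], so the condition says that a(X, Y, Z) - a(Z, Y, X)
   equals its own opposite. *)
have covB' X Y Z :
    g X (cov_deriv11 nabla J Z Y) - g Z (cov_deriv11 nabla J X Y) =
    g' (conn_diff nabla' nabla Z Y) X - g' (conn_diff nabla' nabla X Y) Z.
  by rewrite !covE (symA Z X) opprD addrACA subrr add0r.
split=> [[frob _] X Y Z|cond].
  have outer : g' (conn_diff nabla' nabla X Y) Z =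
               g' (conn_diff nabla' nabla Z Y) X.
    by rewrite frob metric_sym (symA Y).
  by rewrite covB covB' outer.
(* The rewrites turn the Frobenius identity into a(X, Y, Z) = a(Z, Y, X). *)
split=> // X Y Z; rewrite metric_sym [RHS]metric_sym (metric_sym g' Z) (symA Y).
apply: smoothFun_double_inj; move: (cond X Y Z); rewrite covB covB'.
by move/eqP; rewrite subr_eq addrAC eq_sym subr_eq => /eqP.
Qed.
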